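(* For each $n$ let $K_n\subset\mathbb{R}^n$ be a bounded body of unit volume, centrally symmetric about the origin, not necessarily convex. Let $d_n(\varepsilon)$ be the supremum of all possible distances between two subsets of $K_n$ of volume $\varepsilon$. Then for every $\varepsilon\in(0,\frac12)$ $$\liminf_{n\to\infty} d_n(\varepsilon)\ \ge\ -2\frac{1}{\sqrt e}\,\Phi^{-1}(\varepsilon),$$ where the function $-2\frac{1}{\sqrt e}\Phi^{-1}(\varepsilon)$ is asymptotically equivalent to $\frac{2}{\sqrt{\pi e}}\sqrt{-\ln\varepsilon}$ as $\varepsilon\to0^+$ (the ratio tends to $1$).
   Context: $\Phi(a)=\int_{-\infty}^{a}e^{-\pi x^2}\,dx$, an increasing bijection $\mathbb{R}\to(0,1)$, and $\Phi^{-1}$ is its inverse. A body is a Lebesgue measurable set; volume is Lebesgue measure; centrally symmetric about the origin means $K_n=-K_n$. The distance between non-empty sets $A,B$ is $\operatorname{dist}(A,B)=\inf_{x\in A,\,y\in B}\|x-y\|_2$ (Euclidean distance), and $d_n(\varepsilon)=\sup\{\operatorname{dist}(A,B)\}$ over measurable $A,B\subseteq K_n$ of volume exactly $\varepsilon$. *)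

(* Defs.v *)
From HB Require Import structures.
From mathcomp Require Import all_boot all_order all_algebra.
From mathcomp Require Import all_classical all_reals all_analysis.

Set Implicit Arguments.
Unset Strict Implicit.
Unset Printing Implicit Defensive.
Import Order.TTheory GRing.Theory Num.Theory.
Import numFieldNormedType.Exports.

Local Open Scope classical_set_scope.
Local Open Scope ring_scope.

(* The n-fold product of the one-dimensional Lebesgue measure.  Only its values
   on the Borel (product) sigma-algebra of n.-tuple R are meaningful. *)
Fixpoint borel_volume (R : realType) (n : nat) :
    set (n.-tuple (measurableTypeR R)) -> \bar R :=
  match n with
  | 0 => fun A => \d_([tuple] : 0.-tuple (measurableTypeR R)) A
  | m.+1 => fun A =>
      (@lebesgue_measure R \x @borel_volume R m)%E
        ((fun p : measurableTypeR R * m.-tuple (measurableTypeR R) =>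
            cons_tuple p.1 p.2) @^-1` A)
  end.

(* n-dimensional Lebesgue outer measure, transported from tuples of coordinates
   to row vectors; on Lebesgue measurable sets it is the volume. *)
Definition volume (R : realType) (n : nat) (A : set 'rV[R]_n) : \bar R :=
  ((@borel_volume R n)^*)%mu [set t | A (\row_(i < n) tnth t i)].

Definition lebesgue_measurable (R : realType) (n : nat) (A : set 'rV[R]_n) :
  Prop := (@volume R n).-caratheodory A.

Definition norm2 (R : realType) (n : nat) (x : 'rV[R]_n) : R :=
  Num.sqrt (\sum_(i < n) x 0 i ^+ 2).

(* Extended-real valued: equal to +oo when A or B is empty. *)
Definition set_dist (R : realType) (n : nat) (A B : set 'rV[R]_n) : \bar R :=
  ereal_inf [set (norm2 (x - y))%:E | x in A & y in B].

(* The number d_n(eps) attached to the body K in R^n. *)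
Definition max_dist (R : realType) (n : nat) (K : set 'rV[R]_n) (eps : R) :
    \bar R :=
  ereal_sup [set d | exists A B : set 'rV[R]_n,
    [/\ A `<=` K /\ B `<=` K,
        lebesgue_measurable A /\ lebesgue_measurable B,
        volume A = eps%:E /\ volume B = eps%:E &
        d = set_dist A B]].

Definition Phi (R : realType) (a : R) : R :=
  (\int[@lebesgue_measure R]_(x in `]-oo, a]) expR (- (pi * x ^+ 2)))%R.

(* Phi is a bijection from R onto ]0, 1[, so that pinv is its inverse there
   (and is unspecified outside ]0, 1[). *)
Definition Phi_inv (R : realType) : R -> R := pinv setT (@Phi R).

Definition limit_dist (R : realType) (eps : R) : R :=
  - 2 * (1 / Num.sqrt (expR 1)) * Phi_inv eps.

(* Main.v *)
Require Import Defs.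
From HB Require Import structures.
From mathcomp Require Import all_boot all_order all_algebra.
From mathcomp Require Import all_classical all_reals all_analysis.
From mathcomp Require Import measurable_realfun ring lra.

Set Implicit Arguments.
Unset Strict Implicit.
Unset Printing Implicit Defensive.
Import Order.TTheory GRing.Theory Num.Theory.
Import numFieldNormedType.Exports.

Local Open Scope classical_set_scope.
Local Open Scope ring_scope.

(** The lower bound comes from a half-space.  By symmetry of [K], if the slice
    [{x in K : <x, g> <= - t |g|}] has volume at least [eps], then so has its
    opposite, and by Cauchy-Schwarz the two slices are at distance at least
    [2 t] ([max_dist_ge]); both slices can be shrunk to volume exactly [eps]
    ([caratheodory_cut]).  So it is enough to find a direction [g] for which
    the slice is large, with [t] as close as desired to
    [- Phi^-1(eps) / sqrt e].

    Such a direction exists on average.  Take [g] random with density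
    [exp(- pi |g|^2)] on R^n.  For a fixed [x], the scalar product [<x, g>] is
    distributed as [|x|] times a variable with distribution function [Phi]
    ([gauss_halfspace]), and [|g|] concentrates around [sqrt(n / (2 pi))].
    The ball of unit volume has radius about [sqrt(n / (2 pi e))], and when [r]
    is smaller than that by a fixed factor, the volume of the ball of radius
    [r] tends to [0]; hence all but a vanishing part of [K] satisfies
    [|x| >= r].  With [s] slightly larger than [sqrt(n / (2 pi))], the
    quotient [s / r] is close to [sqrt e], and Tonelli's theorem shows that
    the mean over [g] of the volume of [{x in K : <x, g> <= - t s}] is at
    least about [Phi(- t s / r)], which is about [Phi(- t sqrt e)], hence more
    than [eps].  Some [g] with [|g| <= s] thus has a slice of volume at least
    [eps] ([exists_halfspace]).

    Both estimates of small quantities, the volume of a ball that is too small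
    and the probability that [|g|] is too large, are exponential Markov
    inequalities that rest on the single integral
    [int exp(- l |x|^2) dx = sqrt(pi / l) ^ n] ([integral_gauss_tuple]).  They
    decay geometrically in [n].

    The asymptotic equivalence follows from
    [exp(- pi (a + 1)^2) <= Phi(- a) <= exp(- pi a^2)] for [a >= 0]: with
    [a = - Phi^-1(eps)] this reads
    [sqrt pi a <= sqrt(- ln eps) <= sqrt pi (a + 1)]. *)

(** * Lebesgue measure on tuples *)

Section borel_volume_measure.
Variable R : realType.
Local Notation RM := (measurableTypeR R).
Local Notation bv n := (@borel_volume R n).

Definition tcons n (p : RM * n.-tuple RM) : n.+1.-tuple RM :=
  cons_tuple p.1 p.2.

Lemma measurable_tcons n : measurable_fun [set: RM * n.-tuple RM] (@tcons n).
Proof. exact: measurable_cons. Qed.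

Definition tail_tuple n (x : n.+1.-tuple RM) : n.-tuple RM :=
  [tuple of behead x].

Lemma tail_tcons n p : tail_tuple (@tcons n p) = p.2.
Proof. exact/val_inj. Qed.

Let measure_axioms n (m : set (n.-tuple RM) -> \bar R) :=
  [/\ m set0 = 0%E, (forall A, 0 <= m A)%E, semi_sigma_additive m &
      sigma_finite setT m].

Lemma pushforward_tcons_axioms n
    (S : {sigma_finite_measure set (n.-tuple RM) -> \bar R}) :
  measure_axioms (pushforward (@lebesgue_measure R \x S)%E (@tcons n)).
Proof.
pose mt : {mfun _ >-> _} := HB.pack (@tcons n)
  (isMeasurableFun.Build _ _ _ _ _ (@measurable_tcons n)).
rewrite -[@tcons n]/(mt : _ -> _); split.
- exact: measure0.
- by move=> A; exact: measure_ge0.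
- exact: measure_semi_sigma_additive.
- have /sigma_finiteP[F [TF ndF Foo]] := sigma_finiteT (@lebesgue_measure R).
  have /sigma_finiteP[G [TG ndG Goo]] := sigma_finiteT S.
  pose head_tail (t : n.+1.-tuple RM) : RM * n.-tuple RM :=
    (thead t, tail_tuple t).
  have consK : cancel (@tcons n) head_tail.
    by move=> [x t]; rewrite /head_tail tail_tcons.
  have measurable_head_tail : measurable_fun setT head_tail.
    apply: measurable_fun_pair; last exact: measurable_behead.
    exact: measurable_tnth.
  exists (fun k => head_tail @^-1` (F k `*` G k)).
    rewrite -preimage_bigcup (_ : \bigcup_i _ = setT) ?preimage_setT//.
    rewrite -setXTT TF TG; apply/seteqP; split=> -[x y] /=.
      by move=> [k _ []/= ? ?]; split; exists k.
    move=> [/= [i _ Fix] [j _ Gjy]]; exists (maxn i j) => //; split => /=.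
      by move: x Fix; exact/subsetPset/ndF/leq_maxl.
    by move: y Gjy; exact/subsetPset/ndG/leq_maxr.
  move=> k; have [mF Fk] := Foo k; have [mG Gk] := Goo k; split.
    rewrite -[X in measurable X]setTI; apply: measurable_head_tail => //.
    exact: measurableX.
  rewrite /pushforward (_ : mt @^-1` _ = F k `*` G k).
    by rewrite product_measure1E// lte_mul_pinfty// ge0_fin_numE.
  rewrite -comp_preimage (_ : _ \o _ = id) ?preimage_id//.
  exact/funext/consK.
Qed.

(** The sigma-finiteness of the volume in dimension [n] is what makes the
    product in dimension [n + 1] a measure, so all the axioms are proved in
    one induction. *)
Lemma borel_volume_axioms n : measure_axioms (bv n).
Proof.
elim: n => [|n [bv0 bvge0 bvsa bvsf]].
  rewrite /measure_axioms /=; split.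
  - exact: measure0.
  - by move=> A; exact: measure_ge0.
  - exact: measure_semi_sigma_additive.
  - exact: sigma_finiteT.
pose mM := isMeasure.Build _ _ _ (bv n) bv0 bvge0 bvsa.
pose M : {measure set _ -> \bar R} := HB.pack (bv n) mM.
pose mS := Measure_isSigmaFinite.Build _ _ _ M bvsf.
pose S : {sigma_finite_measure set _ -> \bar R} := HB.pack (bv n) mM mS.
exact: (pushforward_tcons_axioms S).
Qed.

HB.instance Definition _ n :=
  let: And4 bv0 bv_ge0 bv_add _ := borel_volume_axioms n in
  isMeasure.Build _ _ _ (bv n) bv0 bv_ge0 bv_add.

HB.instance Definition _ n :=
  let: And4 _ _ _ bv_sf := borel_volume_axioms n in
  Measure_isSigmaFinite.Build _ _ _ (bv n) bv_sf.

End borel_volume_measure.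

Section tuple_integrals.
Variable R : realType.
Local Notation RM := (measurableTypeR R).
Local Notation bv n := (@borel_volume R n).
Local Notation leb := (@lebesgue_measure R).

Definition nsq n (x : n.-tuple RM) : R := \sum_(i < n) tnth x i ^+ 2.
Definition dot n (x y : n.-tuple RM) : R := \sum_(i < n) tnth x i * tnth y i.

Lemma nsq_tcons n (x : RM) (t : n.-tuple RM) :
  nsq (tcons (x, t)) = (x : R) ^+ 2 + nsq t.
Proof.
rewrite /nsq big_ord_recl; congr (_ + _).
by apply: eq_bigr => i _; rewrite tnthS.
Qed.

Lemma dot_tcons n (x y : RM) (s t : n.-tuple RM) :
  dot (tcons (x, s)) (tcons (y, t)) = (x : R) * y + dot s t.
Proof.
rewrite /dot big_ord_recl; congr (_ + _).
by apply: eq_bigr => i _; rewrite !tnthS.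
Qed.

Lemma measurable_nsq n : measurable_fun setT (@nsq n).
Proof.
apply: measurable_sum => i; apply: measurable_funX; exact: measurable_tnth.
Qed.

Lemma measurable_dot d (T : measurableType d) n (f g : T -> n.-tuple RM) :
  measurable_fun setT f -> measurable_fun setT g ->
  measurable_fun setT (fun x => dot (f x) (g x)).
Proof.
move=> mf mg; apply: measurable_sum => i; apply: measurable_funM.
  exact: (measurableT_comp (measurable_tnth i) mf).
exact: (measurableT_comp (measurable_tnth i) mg).
Qed.

Lemma integral_borel_volumeS n (f : n.+1.-tuple RM -> \bar R) :
  measurable_fun setT f -> (forall t, (0 <= f t)%E) ->
  (\int[bv n.+1]_t f t = \int[leb]_x \int[bv n]_t f (tcons (x, t)))%E.
Proof.
move=> mf f0; have mft : measurable_fun setT (f \o @tcons R n).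
  exact: (measurableT_comp mf (@measurable_tcons R n)).
rewrite -[bv n.+1]/(pushforward (leb \x bv n)%E (@tcons R n)).
rewrite ge0_integral_pushforward//=.
  by rewrite preimage_setT (fubini_tonelli1 _ mft)// => p; exact: f0.
exact: measurable_tcons.
Qed.

(** The image of Lebesgue measure under [x |-> (x - d) / s] is [s] times
    Lebesgue measure, since both agree on intervals. *)
Lemma integral_affine (d s : R) (f : RM -> \bar R) : 0 < s ->
  measurable_fun setT f -> (forall x, 0 <= f x)%E ->
  (\int[leb]_x f (((x : R) - d) / s)%R = s%:E * \int[leb]_x f x)%E.
Proof.
move=> s0 mf f0.
pose phi (x : RM) : RM := ((x : R) - d) / s.
have mphi : measurable_fun setT phi.
  by apply: measurable_funM => //; apply: measurable_funB.
transitivity (\int[pushforward leb phi]_x f x)%E.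
  by rewrite ge0_integral_pushforward// preimage_setT.
have s0' : 0 <= s by exact: ltW.
have sV0 : 0 <= s^-1 by rewrite invr_ge0.
rewrite -(@ge0_integral_mscale _ _ R leb setT measurableT (NngNum s0') f)//.
suff pushE A : measurable A -> pushforward leb phi A = (s%:E * leb A)%E.
  by apply: eq_measure_integral => //= A mA _; exact: pushE.
move=> mA; suff -> : leb A = pushforward (mscale (NngNum sV0) leb) phi A.
  by rewrite /pushforward /mscale/= muleA -EFinM divff ?gt_eqF// mul1e.
apply: lebesgue_measure_unique => //=.
move=> _ [[a b]] _ <-.
rewrite /mscale/= /pushforward.
rewrite (_ : phi @^-1` _ = `]s * a + d, s * b + d]%classic).
  rewrite !lebesgue_measure_itv/= !lte_fin ltrD2r ltr_pM2l//.
  case: ifP => _; rewrite ?mule0// -!EFinB -EFinM; congr EFin.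
  by field; rewrite gt_eqF.
apply/seteqP; split=> x /=; rewrite !in_itv/= /phi;
  by rewrite ltr_pdivlMr// ler_pdivrMr// ltrBrDr lerBlDr ![_ * s]mulrC.
Qed.

(** The integrand is a multiple of the density of the normal law of mean [m] and
    variance [1 / (2 l)]. *)
Lemma integral_gauss (l m : R) : 0 < l ->
  (\int[leb]_x (expR (- (l * ((x : R) - m) ^+ 2)))%:E =
   (Num.sqrt (pi / l))%:E)%E.
Proof.
move=> l0; pose s := Num.sqrt (l *+ 2)^-1.
have sE : s ^+ 2 = (l *+ 2)^-1 by rewrite sqr_sqrtr// invr_ge0 mulrn_wge0// ltW.
have s0 : 0 < s by rewrite sqrtr_gt0 invr_gt0 mulrn_wgt0.
have pE x : expR (- (l * (x - m) ^+ 2)) = Num.sqrt (pi / l) * normal_pdf m s x.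
  rewrite normal_pdfE ?gt_eqF//= /normal_peak /normal_fun sE.
  have -> : (l *+ 2)^-1 * pi *+ 2 = pi / l by field; rewrite gt_eqF.
  rewrite [RHS]mulrA divff ?mul1r; last first.
    by rewrite gt_eqF// sqrtr_gt0 divr_gt0// pi_gt0.
  by congr expR; field; rewrite gt_eqF.
under eq_integral do rewrite pE EFinM.
rewrite ge0_integralZl//=.
- by rewrite integral_normal_pdf mule1.
- apply/measurable_EFinP; exact: measurable_normal_pdf.
- by move=> x _; rewrite lee_fin normal_pdf_ge0.
Qed.

Lemma integral_gauss1 : (\int[leb]_x (expR (- (pi * (x : R) ^+ 2)))%:E = 1)%E.
Proof.
under eq_integral do rewrite -[X in X ^+ 2]subr0.
by rewrite integral_gauss ?pi_gt0// divff ?sqrtr1// gt_eqF// pi_gt0.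
Qed.

Lemma measurable_gauss d (T : measurableType d) (l : R) (f : T -> R) :
  measurable_fun setT f -> measurable_fun setT (fun x => expR (- (l * f x))).
Proof.
move=> mf; apply: measurableT_comp => //; apply: measurableT_comp => //.
exact: measurable_funM.
Qed.

Lemma ge0_integralNr (f : RM -> \bar R) :
  measurable_fun setT f -> (forall x, 0 <= f x)%E ->
  (\int[leb]_x f (- (x : R))%R = \int[leb]_x f x)%E.
Proof.
move=> mf f0.
transitivity (\int[pushforward leb (-%R : RM -> RM)]_x f x)%E.
  by rewrite ge0_integral_pushforward// preimage_setT.
by apply: eq_measure_integral => //= A mA _; exact: lebesgue_measureN.
Qed.

End tuple_integrals.
Arguments nsq {R n}.
Arguments dot {R n}.

(** * Gaussian integrals and reflection in several variables *)

Section gauss_tuple.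
Variable R : realType.
Local Notation RM := (measurableTypeR R).
Local Notation bv n := (@borel_volume R n).
Local Notation leb := (@lebesgue_measure R).

Lemma nsq_ge0 n (x : n.-tuple RM) : 0 <= nsq x.
Proof. by apply: sumr_ge0 => i _; exact: sqr_ge0. Qed.

Lemma integral_gauss_tuple n (l : R) : 0 < l ->
  (\int[bv n]_t (expR (- (l * nsq t)))%:E = (Num.sqrt (pi / l) ^+ n)%:E)%E.
Proof.
move=> l0; have mg m : measurable_fun setT
    (fun t : m.-tuple RM => expR (- (l * nsq t))).
  by apply: measurable_gauss; exact: measurable_nsq.
elim: n => [|n IH].
  have mg0 : measurable_fun setT
      (fun t : 0.-tuple RM => (expR (- (l * nsq t)))%:E).
    by apply/measurable_EFinP; exact: mg.
  apply: etrans (integral_dirac [tuple] measurableT mg0) _.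
  by rewrite diracT mul1e /nsq big_ord0 mulr0 oppr0 expR0.
rewrite integral_borel_volumeS//; last by apply/measurable_EFinP; exact: mg.
under eq_integral.
  move=> x _.
  under eq_integral do rewrite nsq_tcons mulrDr opprD expRD EFinM.
  rewrite ge0_integralZl//=; last by apply/measurable_EFinP; exact: mg.
  rewrite IH muleC; over.
rewrite ge0_integralZl//=; last first.
  by apply/measurable_EFinP; apply: measurable_gauss; apply: measurable_funX.
under eq_integral do rewrite -[X in X ^+ 2]subr0.
by rewrite integral_gauss// -EFinM exprSr.
Qed.

Definition opp_tuple n (t : n.-tuple RM) : n.-tuple RM := map_tuple -%R t.

Lemma opp_tcons n (x : RM) (t : n.-tuple RM) :
  opp_tuple (tcons (x, t)) = tcons (- (x : R), opp_tuple t).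
Proof. exact/val_inj. Qed.

Lemma opp_tupleK n : involutive (@opp_tuple n).
Proof.
by move=> t; apply: eq_from_tnth => i; rewrite !tnth_map opprK.
Qed.

Lemma measurable_opp_tuple n : measurable_fun setT (@opp_tuple n).
Proof.
apply/measurable_fun_tnthP => i.
rewrite (_ : _ \o _ = (-%R : R -> R) \o (fun t : n.-tuple RM => tnth t i)).
  by apply: measurableT_comp => //; exact: measurable_tnth.
by apply/funext => t /=; rewrite tnth_map.
Qed.

Lemma integral_opp_tuple n (f : n.-tuple RM -> \bar R) :
  measurable_fun setT f -> (forall t, 0 <= f t)%E ->
  (\int[bv n]_t f (opp_tuple t) = \int[bv n]_t f t)%E.
Proof.
elim: n f => [|n IH] f mf f0.
  by apply: eq_integral => t _; congr f; rewrite tuple0 [RHS]tuple0.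
have mft : measurable_fun setT (f \o @tcons R n).
  exact: (measurableT_comp mf (@measurable_tcons R n)).
rewrite !integral_borel_volumeS//; last first.
  exact: (measurableT_comp mf (@measurable_opp_tuple _)).
transitivity (\int[leb]_x \int[bv n]_t f (tcons ((- (x : R))%R, t)))%E.
  apply: eq_integral => x _.
  under eq_integral do rewrite opp_tcons.
  apply: (IH (fun t => f (tcons ((- (x : R))%R, t)))) => //.
  exact: (measurableT_comp mft (pair1_measurable _)).
apply: (ge0_integralNr (f := fun x => \int[bv n]_t f (tcons (x, t)))%E).
  exact: (measurable_fun_fubini_tonelli_F (m2 := bv n) _ mft
    (fun p => f0 (tcons p))).
by move=> x; exact: integral_ge0.
Qed.

Lemma borel_volume_opp n (A : set (n.-tuple RM)) : measurable A ->
  bv n (@opp_tuple n @^-1` A) = bv n A.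
Proof.
move=> mA; have volE B : measurable B -> bv n B = (\int[bv n]_t (\1_B t)%:E)%E.
  by move=> mB; rewrite integral_indic// setIT.
rewrite !volE//; last first.
  by rewrite -[X in measurable X]setTI; exact: measurable_opp_tuple.
rewrite -(@integral_opp_tuple n (fun t => (\1_A t)%:E))//.
by apply/measurable_EFinP; exact: measurable_indic.
Qed.

End gauss_tuple.

(** * The distribution function Phi *)

Section Phi.
Variable R : realType.
Local Notation RM := (measurableTypeR R).
Local Notation leb := (@lebesgue_measure R).
Local Notation gauss x := (expR (- (pi * x ^+ 2))).
Implicit Types a b x M : R.

Lemma indic_itvNy a x : \1_`]-oo, a] x = ((x <= a)%R)%:R :> R.
Proof.
rewrite indicE; congr (_%:R); congr nat_of_bool.
by apply/idP/idP => [/set_mem|xa]; [|apply/mem_set]; rewrite /= in_itv.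
Qed.

Lemma measurable_gaussR : measurable_fun setT (fun x : R => gauss x).
Proof. by apply: measurable_gauss; exact: measurable_funX. Qed.
#[local] Hint Resolve measurable_gaussR : core.

(** The density [exp(- pi x^2)] is that of the centred normal law of standard
    deviation [1 / sqrt(2 pi)]. *)
Definition std_gauss := normal_prob (0 : R) (Num.sqrt (pi *+ 2)^-1).

HB.instance Definition _ := Probability.on std_gauss.

Lemma std_gaussE (A : set R) :
  std_gauss A = (\int[leb]_(x in A) (gauss x)%:E)%E.
Proof.
rewrite /std_gauss /normal_prob; apply: eq_integral => x _; congr EFin.
have pi2 : 0 < pi *+ 2 :> R by rewrite mulrn_wgt0// pi_gt0.
rewrite normal_pdfE; last by rewrite gt_eqF// sqrtr_gt0 invr_gt0.
rewrite /= /normal_peak /normal_fun sqr_sqrtr; last by rewrite invr_ge0 ltW.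
have -> : (pi *+ 2)^-1 * pi *+ 2 = 1 :> R by rewrite -mulrnAr mulVf ?gt_eqF.
rewrite sqrtr1 invr1 mul1r subr0; congr expR.
have -> : (pi *+ 2)^-1 *+ 2 = pi^-1 :> R.
  by rewrite -mulr_natr -[pi *+ 2]mulr_natr invfM mulfVK ?pnatr_eq0.
by rewrite invrK mulNr mulrC.
Qed.

Lemma EFin_Phi a : (Phi a)%:E = std_gauss `]-oo, a].
Proof.
by rewrite /Phi /Rintegral -std_gaussE fineK//; apply: fin_num_measure.
Qed.

Lemma EFin_Phi_indic a :
  (Phi a)%:E = (\int[leb]_x (\1_`]-oo, a] x * gauss x)%:E)%E.
Proof.
rewrite EFin_Phi std_gaussE integral_mkcond epatch_indic.
by apply: eq_integral => x _; rewrite /= -EFinM mulrC.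
Qed.

Lemma Phi_ge0 a : 0 <= Phi a.
Proof. by rewrite -lee_fin EFin_Phi measure_ge0. Qed.

Lemma Phi_le1 a : Phi a <= 1.
Proof. by rewrite -lee_fin EFin_Phi probability_le1. Qed.

Lemma PhiB a b : a <= b -> (Phi b - Phi a)%:E = std_gauss `]a, b].
Proof.
move=> ab.
have : std_gauss `]-oo, b] = (std_gauss `]-oo, a] + std_gauss `]a, b])%E.
  rewrite -measureU//; last first.
    apply/seteqP; split=> x //=; rewrite !in_itv/= => -[xa /andP[/lt_geF]].
    by rewrite xa.
  by congr std_gauss; rewrite -itv_bndbnd_setU.
by rewrite -!EFin_Phi EFinB => ->; rewrite addeAC subee// add0e.
Qed.

Lemma le_Phi : {homo @Phi R : a b / a <= b}.
Proof. by move=> a b ab; rewrite -subr_ge0 -lee_fin PhiB. Qed.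

Lemma Phi_lipschitz a b : a <= b -> Phi b - Phi a <= b - a.
Proof.
move=> ab; rewrite -lee_fin PhiB// std_gaussE.
have -> : (b - a)%:E = (\int[leb]_(x in `]a, b]) 1)%E.
  rewrite integral_cst// mul1e /= lebesgue_measure_itv/= lte_fin.
  by case: ltgtP ab => // -> _; rewrite subrr.
apply: ge0_le_integral => //=.
- by apply/measurable_EFinP; exact: measurable_funTS.
- move=> x _; rewrite lee_fin -expR0 ler_expR oppr_le0.
  by rewrite mulr_ge0 ?pi_ge0 ?sqr_ge0.
Qed.

(** This single bound yields both the strict monotonicity of [Phi] and the lower
    bound on its tail. *)
Lemma Phi_increment_ge a b M : a <= b -> - M <= a -> b <= M ->
  (b - a) * gauss M <= Phi b - Phi a.
Proof.
move=> ab Ma bM; rewrite -lee_fin PhiB// std_gaussE mulrC.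
have -> : (gauss M * (b - a))%:E = (\int[leb]_(x in `]a, b]) (gauss M)%:E)%E.
  rewrite integral_cst// EFinM /= lebesgue_measure_itv/= lte_fin.
  by case: ltgtP ab => // -> _; rewrite subrr.
apply: ge0_le_integral => //=.
- by apply/measurable_EFinP; exact: measurable_funTS.
- move=> x; rewrite in_itv/= => /andP[ax xb].
  rewrite lee_fin ler_expR lerN2 ler_wpM2l ?pi_ge0//; nra.
Qed.

Lemma lt_Phi : {homo @Phi R : a b / a < b}.
Proof.
move=> a b ab; rewrite -subr_gt0.
apply: (lt_le_trans _ (@Phi_increment_ge a b (`|a| + `|b|) (ltW ab) _ _)).
- by rewrite mulr_gt0 ?subr_gt0// expR_gt0.
- have := ler_norm (- a); rewrite normrN; have := normr_ge0 b; lra.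
- have := ler_norm b; have := normr_ge0 a; lra.
Qed.

Lemma continuous_Phi : continuous (@Phi R).
Proof.
move=> x; apply/cvgrPdist_le => e e0; near=> y.
have le_norm a b : `|Phi a - Phi b| <= `|a - b|.
  wlog ab : a b / b <= a.
    case: (leP b a) => [|/ltW] ab h; first exact: h.
    by rewrite distrC [leRHS]distrC; exact: h.
  by rewrite !ger0_norm ?subr_ge0 ?le_Phi// Phi_lipschitz.
apply: le_trans (le_norm _ _) _; near: y.
exact: cvgr_dist_le.
Unshelve. all: by end_near. Qed.

(** After the translation [x = y - a], the inequality
    [(y - a)^2 >= y^2 + a^2] for [y <= 0 <= a] compares the tail with
    [exp(- pi a^2)] times the total mass. *)
Lemma Phi_tail a : 0 <= a -> Phi (- a) <= gauss a.
Proof.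
move=> a0; rewrite -lee_fin EFin_Phi_indic.
have mf : measurable_fun setT (fun x : R => \1_(`]-oo, - a]) x * gauss x).
  by apply: measurable_funM => //; exact: measurable_indic.
have f0 x : 0 <= \1_(`]-oo, - a]) x * gauss x by rewrite mulr_ge0// expR_ge0.
rewrite -[leLHS]mul1e -(@integral_affine R a 1
  (fun x : RM => (\1_(`]-oo, - a]) x * gauss x)%:E))//; last first.
  exact/measurable_EFinP.
rewrite -[leRHS]mule1 -(@integral_gauss1 R) -ge0_integralZl//=; last first.
  exact/measurable_EFinP.
apply: ge0_le_integral => //=.
- apply/measurable_EFinP.
  apply: (measurableT_comp mf (f := _)); apply: measurable_funM => //.
  exact: measurable_funB.
- by apply/measurable_EFinP; exact: measurable_funM.
- move=> x _; rewrite divr1 -EFinM lee_fin indic_itvNy lerBlDr addNr.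
  case: (leP x 0) => x0; rewrite ?mul1r ?mul0r ?mulr_ge0 ?expR_ge0//.
  by rewrite -expRD ler_expR -opprD lerN2 -mulrDr ler_wpM2l ?pi_ge0//; nra.
Qed.

(** The mass of the interval [[- a - 1, - a]] alone suffices. *)
Lemma Phi_tail_ge a : 0 <= a -> gauss (a + 1) <= Phi (- a).
Proof.
move=> a0; have := @Phi_increment_ge (- (a + 1)) (- a) (a + 1).
rewrite (_ : - a - - (a + 1) = 1) ?mul1r; last lra.
move=> Phi_ge; apply: le_trans (Phi_ge _ _ _) _; try lra.
by rewrite gerBl Phi_ge0.
Qed.

Lemma PhiN a : Phi (- a) = 1 - Phi a.
Proof.
apply/EFin_inj; rewrite EFin_Phi_indic.
have mf : measurable_fun setT (fun x : R => \1_(`]-oo, - a]) x * gauss x).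
  by apply: measurable_funM => //; exact: measurable_indic.
rewrite -(@ge0_integralNr R
  (fun x : RM => (\1_(`]-oo, - a]) x * gauss x)%:E))//; last first.
  exact/measurable_EFinP.
transitivity (\int[leb]_(x in `[a, +oo[) (gauss x)%:E)%E.
  rewrite [RHS]integral_mkcond epatch_indic; apply: eq_integral => x _ /=.
  rewrite -EFinM indic_itvNy lerN2 sqrrN mulrC; congr (_ * _)%:E.
  rewrite indicE; congr (_%:R); congr nat_of_bool.
  apply/idP/idP => [xa|/set_mem]; last by rewrite /= in_itv/= andbT.
  by apply/mem_set; rewrite /= in_itv/= andbT.
rewrite -integral_itv_obnd_cbnd; last exact/measurable_EFinP/measurable_funTS.
by rewrite -std_gaussE -setCitvl probability_setC// EFinB EFin_Phi.
Qed.

Lemma Phi0 : Phi (0 : R) = 1 / 2.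
Proof. by have := PhiN 0; rewrite oppr0; lra. Qed.

Lemma Phi_surj (e : R) : 0 < e < 1 -> exists a, Phi a = e.
Proof.
have small (d : R) : 0 < d -> exists2 M, 0 <= M & gauss M <= d.
  (* With N = |ln d|, pi (1 + N)^2 >= N >= - ln d. *)
  move=> d0; exists (1 + `|ln d|).
    by rewrite addr_ge0.
  rewrite -[leRHS]lnK ?posrE// ler_expR.
  have := ler_norm (- ln d); rewrite normrN; have := normr_ge0 (ln d).
  have := @mulr_ge0 R (pi - 2) ((1 + `|ln d|) ^+ 2).
  rewrite subr_ge0 pi_ge2 sqr_ge0.
  move=> /(_ isT isT); nra.
move=> /andP[e0 e1].
have [M1 M10 M1e] := small _ e0.
have [M2 M20 M2e] : exists2 M, 0 <= M & gauss M <= 1 - e by apply: small; lra.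
have M12 : - M1 <= M2 by lra.
have [||c _ <-] := @IVT R (@Phi R) (- M1) M2 e M12; last by exists c.
  exact/continuous_subspaceT/continuous_Phi.
have := Phi_tail M10; have := Phi_tail M20; rewrite PhiN => P2 P1.
rewrite ge_min le_max; apply/andP; split; apply/orP; [left|right]; lra.
Qed.

Lemma Phi_invK (e : R) : 0 < e < 1 -> Phi (Phi_inv e) = e.
Proof.
move=> /Phi_surj[a <-]; rewrite /Phi_inv.
by rewrite pinvK//; apply/mem_set; exists a.
Qed.

End Phi.

(** * Scalar products with a Gaussian vector *)

Section halfspace.
Variable R : realType.
Local Notation RM := (measurableTypeR R).
Local Notation bv n := (@borel_volume R n).
Local Notation leb := (@lebesgue_measure R).
Local Notation gauss x := (expR (- (pi * x ^+ 2))).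
Implicit Types a b c d r s : R.

Lemma Phi_affine c d s : 0 < s ->
  (\int[leb]_v (\1_`]-oo, c] v * gauss ((v - d) / s))%:E =
   s%:E * (Phi ((c - d) / s))%:E)%E.
Proof.
move=> s0; rewrite EFin_Phi_indic -(@integral_affine R d s)//; last first.
  apply/measurable_EFinP; apply: measurable_funM; last exact: measurable_gaussR.
  exact: measurable_indic.
apply: eq_integral => v _.
by rewrite !indic_itvNy ler_pM2r ?invr_gt0// lerD2r.
Qed.

(** If [U] and [V] are independent with distribution function [Phi], then so has
    [(a U + s V) / sqrt(a^2 + s^2)].  The substitution [v = a b + s u] turns the
    left-hand side into a double integral over [v <= c] and [b]; completing the
    square in [b] gives, with [r^2 = a^2 + s^2],
    [b^2 + ((v - a b) / s)^2 = (r / s)^2 (b - a v / r^2)^2 + (v / r)^2],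
    so that integrating over [b] leaves [exp(- pi (v / r)^2)] up to the factor
    [s / r]. *)
Lemma gauss_convolution a c s : 0 < s ->
  (\int[leb]_b (Phi ((c - a * b) / s) * gauss b)%:E =
   (Phi (c / Num.sqrt (a ^+ 2 + s ^+ 2)))%:E)%E.
Proof.
move=> s0; set r := Num.sqrt _.
have r2 : r ^+ 2 = a ^+ 2 + s ^+ 2 by rewrite sqr_sqrtr// addr_ge0 ?sqr_ge0.
have r0 : 0 < r by rewrite sqrtr_gt0 ltr_wpDl ?sqr_ge0 ?exprn_gt0.
pose F (p : RM * RM) : \bar R :=
  (\1_`]-oo, c] (p.2 : R) *
   (gauss (((p.2 : R) - a * p.1) / s) * gauss (p.1 : R)))%:E.
have mF : measurable_fun setT F.
  apply/measurable_EFinP; apply: measurable_funM.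
    by apply: measurableT_comp => //; exact: measurable_indic.
  apply: measurable_funM; apply: measurable_gauss; apply: measurable_funX => //.
  apply: measurable_funM => //; apply: measurable_funB => //.
  exact: measurable_funM.
have F0 p : (0 <= F p)%E by rewrite lee_fin !mulr_ge0 ?expR_ge0.
transitivity (\int[leb]_b ((s^-1)%:E * \int[leb]_v F (b, v)))%E.
  apply: eq_integral => b _; rewrite /F/=.
  under eq_integral do rewrite mulrA mulrC EFinM.
  rewrite ge0_integralZl//=; last first.
    apply/measurable_EFinP; apply: measurable_funM.
      exact: measurable_indic.
    apply: measurable_gauss; apply: measurable_funX.
    by apply: measurable_funM => //; exact: measurable_funB.
  rewrite Phi_affine// -!EFinM; congr EFin.
  by field; rewrite gt_eqF.
have mG := measurable_fun_fubini_tonelli_F (m2 := leb) _ mF F0.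
rewrite ge0_integralZl//; last 2 first.
- by move=> b _; exact: integral_ge0.
- by rewrite lee_fin invr_ge0 ltW.
rewrite (fubini_tonelli _ mF F0).
transitivity ((s^-1)%:E * \int[leb]_v
    ((s / r)%:E * (\1_`]-oo, c] v * gauss ((v - 0) / r))%:E))%E.
  congr (_ * _)%E; apply: eq_integral => v _; rewrite /F/= subr0.
  have -> : (s / r) = Num.sqrt (pi / (pi * (r / s) ^+ 2)).
    rewrite (_ : pi / _ = (s / r) ^+ 2) ?sqrtr_sqr ?gtr0_norm ?divr_gt0//.
    rewrite -[pi / _]mulrC invfM mulrAC mulVf ?mul1r ?gt_eqF ?pi_gt0//.
    by rewrite -exprVn invf_div.
  rewrite -(@integral_gauss R _ (a * v / r ^+ 2)); last first.
    by rewrite mulr_gt0 ?pi_gt0// exprn_gt0// divr_gt0.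
  rewrite muleC -ge0_integralZl//=; last first.
  - apply/measurable_EFinP; apply: measurable_gauss; apply: measurable_funX.
    exact: measurable_funB.
  apply: eq_integral => b _.
  rewrite -EFinM; congr EFin; rewrite -[RHS]mulrA -!expRD.
  congr (_ * expR _).
  rewrite !exprMn !exprVn r2 -opprD -[in RHS]opprD -mulrA -!mulrDr.
  congr (- (_ * _)).
  by field; rewrite -r2 sqrf_eq0 !gt_eqF.
rewrite ge0_integralZl//; last 2 first.
- apply/measurable_EFinP; apply: measurable_funM; first exact: measurable_indic.
  apply: measurable_gauss; apply: measurable_funX; apply: measurable_funM => //.
  exact: measurable_funB.
- by rewrite lee_fin divr_ge0// ltW.
rewrite Phi_affine// subr0 muleA -!EFinM; congr EFin.
by field; rewrite !gt_eqF.
Qed.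

Lemma measurable_halfspace_gauss n c (x : n.-tuple RM) :
  measurable_fun setT
    (fun g : n.-tuple RM => \1_`]-oo, c] (dot x g) * expR (- (pi * nsq g))).
Proof.
apply: measurable_funM; last by apply: measurable_gauss; exact: measurable_nsq.
apply: measurableT_comp; first exact: measurable_indic.
by apply: measurable_dot => //; exact: measurable_cst.
Qed.

Lemma dot_nsq0 n (x y : n.-tuple RM) : nsq x = 0 -> dot x y = 0.
Proof.
move=> /eqP; rewrite psumr_eq0; last by move=> i _; exact: sqr_ge0.
move=> /allP x0; apply: big1 => i _.
by have := x0 i (mem_index_enum i); rewrite sqrf_eq0 => /eqP ->; rewrite mul0r.
Qed.

Lemma gauss_halfspace1 a c : a != 0 ->
  (\int[leb]_b (\1_`]-oo, c] (a * b) * gauss b)%:E = (Phi (c / `|a|))%:E)%E.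
Proof.
move=> a0.
have mf e : measurable_fun setT (fun b : R => \1_`]-oo, e] b * gauss b).
  apply: measurable_funM; first exact: measurable_indic.
  exact: measurable_gaussR.
rewrite EFin_Phi_indic; case: (ltgtP a 0) a0 => // a0 _.
- rewrite ltr0_norm// -(@ge0_integralNr R
    (fun b : RM => (\1_`]-oo, c / - a] b * gauss b)%:E))//; last first.
    by apply/measurable_EFinP; exact: mf.
  apply: eq_integral => b _; rewrite !indic_itvNy sqrrN.
  by rewrite ler_pdivlMr ?oppr_gt0// mulrNN [b * a]mulrC.
- rewrite gtr0_norm//; apply: eq_integral => b _.
  by rewrite !indic_itvNy ler_pdivlMr// [b * a]mulrC.
Qed.

(** The law of [<x, g>] depends on [x] only through [|x|]: the coordinates of
    [g] are added one at a time with [gauss_convolution].  The case where the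
    remaining coordinates of [x] vanish is apart, because the convolution
    needs a positive scale. *)
Lemma gauss_halfspace n (x : n.-tuple RM) c : 0 < nsq x ->
  (\int[bv n]_g (\1_`]-oo, c] (dot x g) * expR (- (pi * nsq g)))%:E =
   (Phi (c / Num.sqrt (nsq x)))%:E)%E.
Proof.
elim: n x c => [|n IH] x c; first by rewrite /nsq big_ord0 ltxx.
case/tupleP: x => a x; rewrite -[cons_tuple a x]/(tcons (a, x)) nsq_tcons => x0.
rewrite integral_borel_volumeS; last 2 first.
- by apply/measurable_EFinP; exact: measurable_halfspace_gauss.
- by move=> g; rewrite lee_fin mulr_ge0 ?expR_ge0.
have [x'0|x'0] := eqVneq (nsq x) 0.
  rewrite x'0 addr0 sqrtr_sqr -gauss_halfspace1; last first.
    by apply: contraTneq x0 => ->; rewrite expr0n x'0 addr0 ltxx.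
  apply: eq_integral => b _.
  under eq_integral.
    move=> g _; rewrite dot_tcons nsq_tcons (dot_nsq0 _ x'0) addr0.
    rewrite mulrDr opprD expRD mulrA EFinM; over.
  rewrite ge0_integralZl//.
    rewrite integral_gauss_tuple ?pi_gt0// divff ?gt_eqF ?pi_gt0//.
    by rewrite sqrtr1 expr1n mule1.
  by apply/measurable_EFinP; apply: measurable_gauss; exact: measurable_nsq.
have nx : 0 < nsq x by rewrite lt0r x'0 nsq_ge0.
rewrite -[nsq x]sqr_sqrtr ?nsq_ge0// -gauss_convolution ?sqrtr_gt0//.
apply: eq_integral => b _.
under eq_integral.
  move=> g _; rewrite dot_tcons nsq_tcons mulrDr opprD expRD.
  rewrite (_ : \1_`]-oo, c] _ = \1_`]-oo, c - a * b] (dot x g)); last first.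
    by rewrite !indic_itvNy lerBrDl.
  rewrite mulrCA EFinM; over.
rewrite ge0_integralZl//; last first.
  by apply/measurable_EFinP; exact: measurable_halfspace_gauss.
by rewrite IH// muleC EFinM.
Qed.

End halfspace.

(** * A half-space that cuts off a large part of a set *)

Section average.
Variable R : realType.
Local Notation RM := (measurableTypeR R).
Local Notation bv n := (@borel_volume R n).
Implicit Types c e l q r : R.

(** The radius is given by its square [q]. *)
Definition sq_ball n q : set (n.-tuple RM) := [set x | nsq x <= q].

Definition halfspace n (g : n.-tuple RM) c : set (n.-tuple RM) :=
  [set x | dot x g <= c].

Lemma measurable_gauss_tuple n l :
  measurable_fun setT (fun g : n.-tuple RM => expR (- (l * nsq g))).
Proof. by apply: measurable_gauss; exact: measurable_nsq. Qed.

Lemma measurable_sq_ball n q : measurable (@sq_ball n q).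
Proof.
rewrite (_ : sq_ball _ = nsq @^-1` `]-oo, q]).
  by rewrite -[X in measurable X]setTI; exact: measurable_nsq.
by apply/seteqP; split=> x /=; rewrite in_itv.
Qed.

(** Exponential Markov inequality:
    [1 <= exp(l q) exp(- l |x|^2)] on the ball [|x|^2 <= q]. *)
Lemma ball_volume_le n l q : 0 < l ->
  (bv n (sq_ball q) <= (expR (l * q) * Num.sqrt (pi / l) ^+ n)%:E)%E.
Proof.
move=> l0; have mB := @measurable_sq_ball n q.
rewrite -[X in bv n X]setIT -integral_indic// EFinM -integral_gauss_tuple//.
rewrite -ge0_integralZl//; last first.
  by apply/measurable_EFinP; exact: measurable_gauss_tuple.
apply: ge0_le_integral => //.
- by apply/measurable_EFinP; exact: measurable_indic.
- apply/measurable_EFinP; apply: measurable_funM => //.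
  exact: measurable_gauss_tuple.
- move=> x _; rewrite -EFinM lee_fin -expRD -mulrBr indicE.
  case: (boolP (x \in _)) => [/set_mem/= xq|_]; last exact: expR_ge0.
  by rewrite -[leLHS]expR0 ler_expR mulr_ge0 ?subr_ge0// ltW.
Qed.

(** Exponential Markov inequality:
    [exp(- pi |g|^2) <= exp(- (pi - l) q) exp(- l |g|^2)] when [|g|^2 >= q]. *)
Lemma gauss_tuple_tail n l q : 0 < l -> l <= pi ->
  (\int[bv n]_g (\1_(~` sq_ball q) g * expR (- (pi * nsq g)))%:E
    <= (expR (- ((pi - l) * q)) * Num.sqrt (pi / l) ^+ n)%:E)%E.
Proof.
move=> l0 lpi; have mB := measurableC (@measurable_sq_ball n q).
rewrite EFinM -integral_gauss_tuple// -ge0_integralZl//; last first.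
  by apply/measurable_EFinP; exact: measurable_gauss_tuple.
apply: ge0_le_integral => //.
- apply/measurable_EFinP; apply: measurable_funM; first exact: measurable_indic.
  exact: measurable_gauss_tuple.
- apply/measurable_EFinP; apply: measurable_funM => //.
  exact: measurable_gauss_tuple.
- move=> x _; rewrite -EFinM lee_fin -expRD indicE.
  case: (boolP (x \in _)) => [/set_mem/= /negP|_].
    by rewrite -ltNge => qx; rewrite mul1r ler_expR -opprD lerN2; nra.
  by rewrite mul0r expR_ge0.
Qed.

Lemma measurable_halfspace n (g : n.-tuple RM) c : measurable (halfspace g c).
Proof.
rewrite (_ : halfspace g c = (fun x => dot x g) @^-1` `]-oo, c]).
  by rewrite -[X in measurable X]setTI; apply: measurable_dot.
by apply/seteqP; split=> x /=; rewrite in_itv.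
Qed.

(** Integrate the volume of [{x in H : <x, g> <= c}] against the Gaussian
    density of [g].  Integrating over [g] first, [gauss_halfspace] shows that
    each [x] of [H] outside the ball of radius [r] contributes at least
    [Phi(c / r)], since [c <= 0].  Integrating over [x] first, if every [g] in
    the ball [|g|^2 <= q] had a slice of volume less than [e], the result would
    be at most [e + t], the slices for the other [g] being bounded by the volume
    of [H]. *)
Lemma exists_halfspace n (H : set (n.-tuple RM)) c q r e b t :
  measurable H -> bv n H = 1%E -> c <= 0 -> 0 < r ->
  (bv n (sq_ball (r ^+ 2)) <= b%:E)%E ->
  (\int[bv n]_g (\1_(~` sq_ball q) g * expR (- (pi * nsq g)))%:E <= t%:E)%E ->
  0 <= e -> e + t < Phi (c / r) * (1 - b) ->
  exists2 g, nsq g <= q & (e%:E <= bv n (H `&` halfspace g c))%E.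
Proof.
move=> mH H1 c0 r0 Bb Tt e0 etP; apply: contrapT => noG.
have small g : nsq g <= q -> (bv n (H `&` halfspace g c) <= e%:E)%E.
  by move=> gq; rewrite leNgt; apply/negP => /ltW eg; apply: noG; exists g.
pose F (p : n.-tuple RM * n.-tuple RM) : \bar R :=
  (\1_H p.1 * (\1_`]-oo, c] (dot p.1 p.2) * expR (- (pi * nsq p.2))))%:E.
have mF : measurable_fun setT F.
  apply/measurable_EFinP; apply: measurable_funM.
    by apply: measurableT_comp => //; exact: measurable_indic.
  apply: measurable_funM.
    apply: measurableT_comp; first exact: measurable_indic.
    exact: measurable_dot.
  apply: measurable_gauss; apply: measurableT_comp => //.
  exact: measurable_nsq.
have F0 p : (0 <= F p)%E by rewrite lee_fin !mulr_ge0 ?expR_ge0.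
pose B := @sq_ball n (r ^+ 2).
have mB : measurable B by exact: measurable_sq_ball.
have lower :
    ((Phi (c / r) * (1 - b))%:E <= \int[bv n]_x \int[bv n]_g F (x, g))%E.
  apply: (@le_trans _ _ ((Phi (c / r))%:E * bv n (H `\` B))%E).
    rewrite EFinM lee_wpmul2l ?lee_fin ?Phi_ge0//.
    have : bv n H = (bv n (H `\` B) + bv n (H `&` B))%E by exact: measureDI.
    rewrite H1 => H1E; rewrite EFinB leeBlDr// H1E leeD2l//.
    apply: le_trans Bb.
    by apply: le_measure; rewrite ?inE//; exact: measurableI.
  rewrite -[X in bv n X]setIT -integral_indic//; last exact: measurableD.
  rewrite -ge0_integralZl//; last first.
  - by rewrite lee_fin Phi_ge0.
  - by apply/measurable_EFinP; apply: measurable_indic; exact: measurableD.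
  apply: ge0_le_integral => //.
  - by move=> x _; rewrite mule_ge0 ?lee_fin ?Phi_ge0.
  - apply: measurable_funeM; apply/measurable_EFinP.
    by apply: measurable_indic; exact: measurableD.
  - exact: (measurable_fun_fubini_tonelli_F (m2 := bv n) _ mF F0).
  - move=> x _; rewrite indicE.
    case: (boolP (x \in _)) => [/set_mem/= [Hx /negP]|_].
      rewrite -ltNge => rx.
      have nx : 0 < nsq x by apply: le_lt_trans rx; exact: sqr_ge0.
      rewrite mule1 /F/= indicE mem_set//.
      under eq_integral do rewrite mul1r.
      rewrite gauss_halfspace// lee_fin le_Phi// ler_wnM2l//.
      rewrite lef_pV2 ?posrE ?sqrtr_gt0//.
      by rewrite -[r]gtr0_norm// -sqrtr_sqr ler_wsqrtr// ltW.
    rewrite mule0; exact: integral_ge0.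
have upper : (\int[bv n]_g \int[bv n]_x F (x, g) <= (e + t)%:E)%E.
  have mhalf g : measurable (H `&` halfspace g c).
    by apply: measurableI => //; exact: measurable_halfspace.
  have intF g : (\int[bv n]_x F (x, g) =
      (expR (- (pi * nsq g)))%:E * bv n (H `&` halfspace g c))%E.
    rewrite -[X in bv n X]setIT -integral_indic// -ge0_integralZl//; last first.
      by apply/measurable_EFinP; exact: measurable_indic.
    apply: eq_integral => x _; rewrite /F/= -EFinM mulrA mulrC.
    congr (_ * _)%:E.
    by rewrite indicI; congr (_ * _).
  under eq_integral do rewrite intF.
  have mT : measurable_fun setT (fun g : n.-tuple RM =>
      (\1_(~` sq_ball q) g * expR (- (pi * nsq g)))%:E).
    apply/measurable_EFinP; apply: measurable_funM; last first.
      exact: measurable_gauss_tuple.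
    by apply: measurable_indic; apply: measurableC; exact: measurable_sq_ball.
  have mG : measurable_fun setT
      (fun g : n.-tuple RM => (expR (- (pi * nsq g)))%:E).
    by apply/measurable_EFinP; exact: measurable_gauss_tuple.
  apply: (@le_trans _ _ (\int[bv n]_g (e%:E * (expR (- (pi * nsq g)))%:E +
      (\1_(~` sq_ball q) g * expR (- (pi * nsq g)))%:E))%E).
    apply: ge0_le_integral => //.
    - by move=> g _; rewrite mule_ge0 ?lee_fin ?expR_ge0.
    - apply: (eq_measurable_fun (fubini_G (bv n) F)) => [g _|].
        by rewrite -intF.
      exact: (measurable_fun_fubini_tonelli_G (m1 := bv n) _ mF F0).
    - by apply: emeasurable_funD => //; exact: measurable_funeM.
    - move=> g _; have [gq|gq] := leP (nsq g) q.
        apply: (@le_trans _ _ (e%:E * (expR (- (pi * nsq g)))%:E)%E).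
          by rewrite muleC lee_wpmul2r ?lee_fin ?expR_ge0// small.
        by rewrite leeDl// lee_fin mulr_ge0 ?expR_ge0.
      rewrite indicE mem_set/=; last by apply/negP; rewrite -ltNge.
      rewrite mul1r -[leLHS]add0e leeD ?mule_ge0 ?lee_fin ?expR_ge0//.
      rewrite -[leRHS]mule1 lee_wpmul2l ?lee_fin ?expR_ge0// -H1.
      by apply: le_measure; rewrite ?inE//; exact: subIsetl.
  rewrite ge0_integralD//; last first.
  - exact: measurable_funeM.
  - by move=> g _; rewrite mule_ge0 ?lee_fin ?expR_ge0.
  rewrite ge0_integralZl// integral_gauss_tuple ?pi_gt0//.
  by rewrite divff ?gt_eqF ?pi_gt0// sqrtr1 expr1n mule1 EFinD leeD.
have := le_trans lower _; rewrite (fubini_tonelli _ mF F0) => /(_ _ upper).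
by rewrite lee_fin leNgt etP.
Qed.

End average.

(** * Lebesgue outer measure: Borel hulls, reflection, slabs *)

Section outer.
Variable R : realType.
Local Notation RM := (measurableTypeR R).
Local Notation bv n := (@borel_volume R n).
Implicit Types c e q r s t u v M : R.

Definition outer n : set (n.-tuple RM) -> \bar R := ((bv n)^*)%mu.

HB.instance Definition _ n := OuterMeasure.on (@outer n).

Lemma outerE n (A : set (n.-tuple RM)) : measurable A -> outer A = bv n A.
Proof. exact: measurable_mu_extE. Qed.

Lemma measurable_caratheodory n (A : set (n.-tuple RM)) :
  measurable A -> (@outer n).-caratheodory A.
Proof. exact: caratheodory_measurable_mu_ext. Qed.

(** Intersect a sequence of countable Borel covers of [A] whose total measures
    exceed that of [A] by [1 / (k + 1)]. *)
Lemma borel_hull n (A : set (n.-tuple RM)) (v : R) : outer A = v%:E ->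
  exists H, [/\ measurable H, A `<=` H & bv n H = v%:E].
Proof.
move=> Av.
have cover k : exists U : set (n.-tuple RM),
    [/\ measurable U, A `<=` U & (bv n U <= v%:E + (k.+1%:R^-1)%:E)%E].
  have k0 : 0 < k.+1%:R^-1 :> R by rewrite invr_gt0 ltr0n.
  have Afin : outer A \is a fin_num by rewrite Av.
  have [_ [F [mF AF] <-] Flt] := lb_ereal_inf_adherent k0 Afin.
  have mU : measurable (\bigcup_i F i) by exact: bigcup_measurable.
  exists (\bigcup_i F i); split => //.
  apply: le_trans (measure_sigma_subadditive _ mF mU _) _ => //.
  by rewrite -Av; exact: ltW.
have /choice[U UP] := cover.
exists (\bigcap_k U k); split.
- by apply: bigcapT_measurable => k; have [] := UP k.
- by move=> x Ax k _; have [_ AU _] := UP k; exact: AU.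
apply/eqP; rewrite eq_le; apply/andP; split.
  apply/lee_addgt0Pr => e e0.
  have [k ke] : exists k, (k.+1%:R^-1 <= e)%R.
    exists (Num.truncn e^-1); rewrite -[leRHS]invrK.
    rewrite lef_pV2 ?posrE ?ltr0n ?invr_gt0//.
    by rewrite ltW// truncnS_gt.
  have [mU AU Uk] := UP k.
  apply: (@le_trans _ _ (bv n (U k))).
    apply: le_measure; rewrite ?inE//; last by move=> x /(_ k I).
    by apply: bigcapT_measurable => j; have [] := UP j.
  by apply: le_trans Uk _; rewrite leeD2l// lee_fin.
rewrite -Av -outerE; last by apply: bigcapT_measurable => j; have [] := UP j.
by apply: le_outer_measure => x Ax k _; have [_ AU _] := UP k; exact: AU.
Qed.

(** Tonelli's theorem needs a Borel set: a Lebesgue measurable [K] is replaced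
    by a Borel hull [H].  As [H] minus [K] is a null set, large Borel slices of
    [H] give equally large slices of [K]. *)
Lemma caratheodory_borel_hull n (K : set (n.-tuple RM)) (v : R) :
  (@outer n).-caratheodory K -> outer K = v%:E ->
  exists2 H, measurable H /\ bv n H = v%:E &
    forall S, measurable S -> (bv n (H `&` S) <= outer (K `&` S))%E.
Proof.
move=> mK Kv; have [H [mH KH Hv]] := borel_hull Kv; exists H => // S mS.
have HK0 : outer (H `&` ~` K) = 0%E.
  have := mK H; rewrite outerE// Hv (setIidr KH) Kv.
  case: (outer _) => [x||]//= /eqP; rewrite -EFinD eqe eq_sym.
  by rewrite -subr_eq0 addrAC subrr add0r => /eqP ->.
rewrite -outerE; last exact: measurableI.
apply: (@le_trans _ _ (outer ((K `&` S) `|` (H `&` ~` K)))).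
  apply: le_outer_measure => x [Hx Sx].
  by have [Kx|Kx] := pselect (K x); [left|right].
apply: le_trans (outer_measureU2 _ _ _) _.
by rewrite [X in (_ + X)%E]HK0 adde0.
Qed.

Lemma outer_opp_le n (A : set (n.-tuple RM)) :
  (outer (@opp_tuple R n @^-1` A) <= outer A)%E.
Proof.
apply: le_ereal_inf_tmp => _ [F [mF AF] <-].
apply: ereal_inf_lbound; exists (fun k => @opp_tuple R n @^-1` F k).
  split=> [k|x /AF [k _ Fk]]; last by exists k.
  by rewrite -[X in measurable X]setTI; exact: measurable_opp_tuple.
by apply: eq_eseriesr => k _; rewrite borel_volume_opp.
Qed.

Lemma outer_opp n (A : set (n.-tuple RM)) :
  outer (@opp_tuple R n @^-1` A) = outer A.
Proof.
apply/eqP; rewrite eq_le outer_opp_le/=.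
rewrite -[X in (outer X <= _)%E](_ :
  @opp_tuple R n @^-1` (@opp_tuple R n @^-1` A) = A).
  exact: outer_opp_le.
by apply/seteqP; split=> x /=; rewrite opp_tupleK.
Qed.

Lemma caratheodory_opp n (A : set (n.-tuple RM)) :
  (@outer n).-caratheodory A ->
  (@outer n).-caratheodory (@opp_tuple R n @^-1` A).
Proof.
move=> cA X; pose Y := @opp_tuple R n @^-1` X.
have YE B : outer (Y `&` B) = outer (X `&` @opp_tuple R n @^-1` B).
  rewrite -outer_opp; congr (outer _).
  by apply/seteqP; split=> x /=; rewrite /Y /= opp_tupleK.
by rewrite -[LHS]outer_opp -/Y [LHS]cA !YE.
Qed.

Definition cube n M : set (n.-tuple RM) := [set x | forall i, `|tnth x i| <= M].

Lemma measurable_cube n M : measurable (@cube n M).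
Proof.
rewrite (_ : cube M =
  \bigcap_(i in [set: 'I_n]) (fun x => tnth x i) @^-1` `[- M, M]).
  apply: fin_bigcap_measurable => // i _.
  by rewrite -[X in measurable X]setTI; exact: measurable_tnth.
apply/seteqP; split=> x /= xM i.
  by move=> _; rewrite /= in_itv/= -ler_norml.
by have := xM i I; rewrite /= in_itv/= -ler_norml.
Qed.

Lemma borel_volumeX n (X : set (n.+1.-tuple RM)) A B :
  measurable A -> measurable B -> @tcons R n @^-1` X = A `*` B ->
  bv n.+1 X = (@lebesgue_measure R A * bv n B)%E.
Proof.
by move=> mA mB XE; rewrite -product_measure1E// -XE.
Qed.

Lemma cube_finite n M : (bv n (cube M) < +oo)%E.
Proof.
elim: n => [|n IH]; first by rewrite /= ltry.
rewrite (@borel_volumeX _ _ `[- M, M] (cube M))//; last 2 first.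
- exact: measurable_cube.
- apply/seteqP; split=> -[x t] /=; rewrite /cube /= in_itv/= -ler_norml.
    move=> xM; split=> [|i]; first exact: (xM ord0).
    by have := xM (lift ord0 i); rewrite tnthS.
  by move=> [xM tM] i; case: (unliftP ord0 i) => [j|] ->; rewrite ?tnthS.
by rewrite lte_mul_pinfty// lebesgue_measure_itv/=; case: ifP.
Qed.

Definition slab n (u v : R) : set (n.+1.-tuple RM) :=
  [set x | u < thead x <= v].

Lemma measurable_slab n (u v : R) : measurable (@slab n u v).
Proof.
rewrite (_ : slab _ _ = (fun x => tnth x ord0) @^-1` `]u, v]).
  by rewrite -[X in measurable X]setTI; exact: measurable_tnth.
by apply/seteqP; split=> x /=; rewrite in_itv.
Qed.

Lemma slab_cube n M u v : u <= v ->
  (bv n.+1 (slab u v `&` cube M) <= (v - u)%:E * bv n (cube M))%E.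
Proof.
move=> uv.
pose S := [set x : n.+1.-tuple RM | slab u v x /\ cube M (tail_tuple x)].
have mS : measurable S.
  apply: measurableI; first exact: measurable_slab.
  rewrite -[X in measurable X]setTI; apply: measurable_behead => //.
  exact: measurable_cube.
have SE : bv n.+1 S = ((v - u)%:E * bv n (cube M))%E.
  rewrite (@borel_volumeX _ _ `]u, v] (cube M))//; last 2 first.
  - exact: measurable_cube.
  - apply/seteqP; split=> p; rewrite /S /preimage /mkset tail_tcons;
      by rewrite /slab /= in_itv.
  rewrite lebesgue_measure_itv/= lte_fin -EFinB; congr (_ * _)%E.
  by case: ltgtP uv => // -> _; rewrite subrr.
rewrite -SE; apply: le_measure; rewrite ?inE//.
  by apply: measurableI; [exact: measurable_slab|exact: measurable_cube].
by move=> x [uxv xM]; split=> // i; rewrite tnth_behead; exact: xM.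
Qed.

End outer.

(** * Two distant subsets of prescribed volume *)

Section cutting.
Variable R : realType.
Local Notation RM := (measurableTypeR R).
Local Notation bv n := (@borel_volume R n).
Implicit Types c e q r s t u v M : R.

(** The part of [A] on which the first coordinate is at most [u] has a volume
    that is Lipschitz in [u], because [A] lies in a cube ([slab_cube]); the
    intermediate value theorem applies. *)
Lemma caratheodory_cut n (A : set (n.+1.-tuple RM)) M e :
  (@outer R n.+1).-caratheodory A -> 0 <= M -> A `<=` cube M ->
  0 <= e -> (e%:E <= outer A)%E ->
  exists A', [/\ A' `<=` A, (@outer R n.+1).-caratheodory A' & outer A' = e%:E].
Proof.
move=> cA M0 AM e0 eA.
(* The lower end - (M + 1) leaves nothing of the cube below the slab. *)
pose cut u := A `&` slab (- (M + 1)) u.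
have cut_car u : (@outer R n.+1).-caratheodory (cut u).
  apply: caratheodory_measurable_setI => //.
  by apply: measurable_caratheodory; exact: measurable_slab.
have cutM u : (outer (cut u) <= bv n.+1 (cube M))%E.
  rewrite -outerE; last exact: measurable_cube.
  by apply: le_outer_measure => x [/AM].
pose f u := fine (outer (cut u)).
have fE u : (f u)%:E = outer (cut u).
  rewrite fineK// ge0_fin_numE ?outer_measure_ge0//.
  by apply: le_lt_trans (cutM u) _; exact: cube_finite.
pose C := fine (bv n (cube M)).
have CE : C%:E = bv n (cube M).
  by rewrite fineK// ge0_fin_numE// cube_finite.
have C0 : 0 <= C by rewrite -lee_fin CE.
have f_mono u v : u <= v -> f u <= f v.
  move=> uv; rewrite -lee_fin !fE.
  apply: le_outer_measure => x [Ax /andP[ux xu]].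
  by split=> //; rewrite /slab /= ux (le_trans xu).
have f_lip u v : u <= v -> f v - f u <= C * (v - u).
  move=> uv; rewrite lerBlDl -lee_fin EFinD EFinM !fE CE.
  apply: (@le_trans _ _ (outer (cut u `|` (slab u v `&` cube M)))).
    apply: le_outer_measure => x [Ax /andP[xM xv]].
    have [xu|ux] := leP (thead x) u; [left|right].
      by split=> //; rewrite /slab /= xM.
    by split; [rewrite /slab /= ux|exact: AM].
  apply: le_trans (outer_measureU2 _ _ _) _; apply: leeD2l.
  rewrite [leLHS]outerE; first by rewrite muleC slab_cube.
  by apply: measurableI; [exact: measurable_slab|exact: measurable_cube].
have f_cont : continuous f.
  move=> x; apply/cvgrPdist_le => d d0; near=> y.
  have f_dist u v : `|f u - f v| <= C * `|u - v|.
    wlog uv : u v / v <= u.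
      case: (leP v u) => [|/ltW] uv h; first exact: h.
      by rewrite distrC [`|u - v|]distrC; exact: h.
    by rewrite !ger0_norm ?subr_ge0 ?f_mono// f_lip.
  apply: le_trans (f_dist _ _) _.
  apply: (@le_trans _ _ ((C + 1) * `|x - y|)).
    by rewrite ler_wpM2r// lerDl.
  rewrite -ler_pdivlMl ?ltr_wpDl//; near: y; apply: cvgr_dist_le => //.
  by rewrite mulr_gt0// invr_gt0 ltr_wpDl.
have f0 : f (- (M + 1)) = 0.
  apply: EFin_inj; rewrite fE (_ : cut _ = set0) ?outer_measure0//.
  by apply/seteqP; split=> x //= [_ /andP[/lt_geF ->]].
have fM : (f M)%:E = outer A.
  rewrite fE; congr outer; apply/seteqP; split=> x; first by case.
  move=> Ax; split=> //; have := AM _ Ax ord0.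
  rewrite /slab /= ler_norml => /andP[h ->].
  rewrite andbT; apply: lt_le_trans h; lra.
have MM : - (M + 1) <= M by lra.
have [||c _ fc] := @IVT R f _ _ e MM.
- exact: continuous_subspaceT.
- rewrite f0 ge_min e0/= le_max; apply/orP; right.
  by rewrite -lee_fin fM.
- by exists (cut c); split=> //; [move=> x []|rewrite -fE fc].
Unshelve. all: by end_near. Qed.

Definition row_of n (x : n.-tuple RM) : 'rV[R]_n := \row_(i < n) tnth x i.
Definition tuple_of n (x : 'rV[R]_n) : n.-tuple RM := [tuple x 0 i | i < n].

Lemma row_ofK n : cancel (@row_of n) (@tuple_of n).
Proof. by move=> x; apply: eq_from_tnth => i; rewrite tnth_mktuple mxE. Qed.

Lemma tuple_ofK n : cancel (@tuple_of n) (@row_of n).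
Proof. by move=> x; apply/rowP => i; rewrite mxE tnth_mktuple. Qed.

Lemma row_of_opp n (x : n.-tuple RM) : row_of (opp_tuple x) = - row_of x.
Proof. by apply/rowP => i; rewrite !mxE tnth_map. Qed.

Lemma volume_outer n (A : set 'rV[R]_n) : volume A = outer (@row_of n @^-1` A).
Proof. by []. Qed.

Lemma lebesgue_measurable_caratheodory n (A : set 'rV[R]_n) :
  lebesgue_measurable A <-> (@outer R n).-caratheodory (@row_of n @^-1` A).
Proof.
split=> cA X.
  have := cA (@tuple_of n @^-1` X).
  rewrite !volume_outer !preimage_setI preimage_setC.
  by rewrite (_ : @row_of n @^-1` (@tuple_of n @^-1` X) = X)//;
    apply/seteqP; split=> x /=; rewrite row_ofK.
by rewrite !volume_outer !preimage_setI preimage_setC; exact: cA.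
Qed.

Lemma bounded_cube n (K : set 'rV[R]_n) : bounded_set K ->
  exists2 M, 0 <= M & @row_of n @^-1` K `<=` cube M.
Proof.
move=> [M0 [_ bK]]; exists (`|M0| + 1); first by rewrite addr_ge0.
move=> x Kx i; have := bK (`|M0| + 1) _ (row_of x) Kx.
have M0lt : M0 < `|M0| + 1 by apply: le_lt_trans (ler_norm _) _; rewrite ltrDl.
move=> /(_ M0lt); apply: le_trans.
rewrite [leRHS]/Num.norm /= mx_normrE; apply/bigmax_geP; right.
by exists (0, i) => //=; rewrite mxE.
Qed.

(** A Cauchy-Schwarz inequality, obtained by expanding the sum of the squares
    [(x_i - (t / s) g_i)^2]. *)
Lemma sum_sqr_ge_of_dot n (x g : 'I_n -> R) s t : 0 < s -> 0 <= t ->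
  \sum_i g i ^+ 2 <= s ^+ 2 -> t * s <= \sum_i x i * g i ->
  t ^+ 2 <= \sum_i x i ^+ 2.
Proof.
move=> s0 t0 gs xg; pose a := t / s.
have a0 : 0 <= a by rewrite divr_ge0// ltW.
have tE : t = a * s by rewrite divfK// gt_eqF.
have : 0 <= \sum_i (x i - a * g i) ^+ 2.
  by apply: sumr_ge0 => i _; exact: sqr_ge0.
under eq_bigr do rewrite sqrrB exprMn mulrCA -mulrnAr.
rewrite big_split/= sumrB -!mulr_sumr sumrMnl => h.
move: h gs xg; rewrite tE; set X := \sum_i x i ^+ 2; set G := \sum_i g i ^+ 2.
set D := \sum_i _ => h gs xg.
have : a * (a * s * s) <= a * D by rewrite ler_wpM2l.
have : a ^+ 2 * G <= a ^+ 2 * s ^+ 2 by rewrite ler_wpM2l// sqr_ge0.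
nra.
Qed.

(** Cut the slice down to a subset [A1] of volume [e] and take its opposite
    [B1].  If [x] is in [A1] and [y] in [B1], then [<x, g>] and [<- y, g>] are at most
    [- t s], so that [<y - x, g> >= 2 t s], while [|g| <= s]. *)
Lemma max_dist_ge n (K : set 'rV[R]_n.+1) (g : n.+1.-tuple RM) s t e :
  bounded_set K -> lebesgue_measurable K -> K = [set - x | x in K] ->
  0 < s -> 0 <= t -> nsq g <= s ^+ 2 -> 0 <= e ->
  (e%:E <= outer ((@row_of n.+1 @^-1` K) `&` halfspace g (- (t * s))))%E ->
  ((2 * t)%:E <= max_dist K e)%E.
Proof.
move=> /bounded_cube[M M0 KM] /lebesgue_measurable_caratheodory cK sK.
move=> s0 t0 gs e0 eK.
set pK := @row_of n.+1 @^-1` K in KM cK eK.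
have mH := measurable_halfspace g (- (t * s)).
have [A [AK cA Ae]] := @caratheodory_cut n _ M e
  (caratheodory_measurable_setI cK (measurable_caratheodory mH)) M0
  (subset_trans (@subIsetl _ _ _) KM) e0 eK.
pose A1 := @tuple_of n.+1 @^-1` A.
pose B1 := [set x | A1 (- x)].
have A1E : @row_of n.+1 @^-1` A1 = A.
  by apply/seteqP; split=> x /=; rewrite /A1/= row_ofK.
have B1E : @row_of n.+1 @^-1` B1 = @opp_tuple R n.+1 @^-1` A.
  by apply/seteqP; split=> x /=; rewrite /B1 /A1/= -row_of_opp row_ofK.
have A1K : A1 `<=` K by move=> x /AK[]; rewrite /pK /= tuple_ofK.
apply: (@le_trans _ _ (set_dist A1 B1)); last first.
  apply: ereal_sup_ubound; exists A1, B1; split=> //.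
  - by split=> // x /A1K Kx; rewrite sK; exists (- x) => //; rewrite opprK.
  - split; apply/lebesgue_measurable_caratheodory; rewrite ?A1E// B1E.
    exact: caratheodory_opp.
  - by rewrite !volume_outer A1E B1E; split=> //; rewrite outer_opp.
apply: le_ereal_inf_tmp => _ [x A1x [y B1y <-]]; rewrite lee_fin /norm2.
have dotA z : A1 z -> \sum_i z 0 i * tnth g i <= - (t * s).
  move=> /AK[_ zg]; rewrite (_ : \sum_i _ = dot (tuple_of z) g)//.
  by apply: eq_bigr => i _; rewrite tnth_mktuple.
rewrite -[leLHS]ger0_norm ?mulr_ge0// -sqrtr_sqr ler_wsqrtr//.
apply: (@sum_sqr_ge_of_dot _ _ (fun i => - tnth g i) s) => //.
  by rewrite mulr_ge0.
  by under eq_bigr do rewrite sqrrN.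
have := dotA _ B1y; have := dotA _ A1x.
rewrite [X in _ -> _ -> _ <= X](_ : _ =
    - (\sum_i x 0 i * tnth g i) - (\sum_i (- y) 0 i * tnth g i)); first lra.
by rewrite -!sumrN -big_split/=; apply: eq_bigr => i _; rewrite !mxE; ring.
Qed.

End cutting.

(** * The limit distance and the limit inferior *)

Section asymptotics.
Variable R : realType.

Lemma Phi_inv_lt0 (e : R) : 0 < e -> e < 1 / 2 -> Phi_inv e < 0.
Proof.
move=> e0 e12; have eK : Phi (Phi_inv e) = e by apply: Phi_invK; lra.
rewrite ltNge; apply/negP => /le_Phi; rewrite Phi0 eK; lra.
Qed.

Lemma Phi_inv_bounds (e : R) : 0 < e -> e < 1 / 2 ->
  pi * (- Phi_inv e) ^+ 2 <= - ln e <= pi * (- Phi_inv e + 1) ^+ 2.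
Proof.
move=> e0 e12; have a0 := Phi_inv_lt0 e0 e12.
have eK : Phi (- - Phi_inv e) = e by rewrite opprK; apply: Phi_invK; lra.
have a0' : 0 <= - Phi_inv e by lra.
have := Phi_tail a0'; have := Phi_tail_ge a0'; rewrite eK.
have eE : e = expR (ln e) by rewrite lnK.
rewrite [X in _ <= X -> _]eE [X in _ -> X <= _ -> _]eE !ler_expR; lra.
Qed.

(** With [a = - Phi^-1(eps)] and [L = sqrt(- ln eps)] the ratio is
    [sqrt pi a / L], which lies between [1 - sqrt pi / L] and [1] by
    [Phi_inv_bounds]. *)
Lemma limit_dist_equiv :
  limit_dist eps / (2 / Num.sqrt (pi * expR 1) * Num.sqrt (- ln eps))
    @[eps --> 0^'+] --> (1 : R).
Proof.
apply/cvgrPdist_le => d d0; near=> e.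
have e0 : 0 < e by near: e; exact: nbhs_right_gt.
have e12 : e < 1 / 2 by near: e; apply: nbhs_right_lt; lra.
have ed : e < expR (- (pi / d ^+ 2)).
  by near: e; apply: nbhs_right_lt; exact: expR_gt0.
have a0 : 0 < - Phi_inv e by rewrite oppr_gt0 Phi_inv_lt0.
have pi0 := @pi_gt0 R.
have /andP[lo hi] := Phi_inv_bounds e0 e12.
rewrite /limit_dist; set a := - Phi_inv e in a0 lo hi.
have -> : Phi_inv e = - a by rewrite opprK.
set L := Num.sqrt (- ln e); pose p : R := Num.sqrt pi.
set w := Num.sqrt (expR 1).
have p0 : 0 < p by rewrite sqrtr_gt0.
have w0 : 0 < w by rewrite sqrtr_gt0 expR_gt0.
have loL : p * a <= L.
  by rewrite /p -[a]gtr0_norm// -sqrtr_sqr -sqrtrM ?(ltW pi0)// /L ler_wsqrtr.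
have hiL : L <= p * (a + 1).
  rewrite /p -[a + 1]gtr0_norm ?addr_gt0// -sqrtr_sqr.
  by rewrite -sqrtrM ?(ltW pi0)// /L ler_wsqrtr.
have L0 : 0 < L by apply: lt_le_trans loL; exact: mulr_gt0.
have dL : p / d <= L.
  rewrite /p -[d]gtr0_norm// -sqrtr_sqr -sqrtrV ?sqr_ge0//.
  rewrite -sqrtrM ?(ltW pi0)// /L ler_wsqrtr//.
  by rewrite lerNr -ler_expR lnK ?posrE// ltW.
have -> : - 2 * (1 / w) * - a / (2 / Num.sqrt (pi * expR 1) * L) = p * a / L.
  by rewrite sqrtrM ?(ltW pi0)// -/p -/w; field; rewrite !gt_eqF.
rewrite ger0_norm.
  rewrite lerBlDr -lerBlDl ler_pdivlMr// mulrBl mul1r lerBlDr.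
  move: dL; rewrite ler_pdivrMr//; lra.
by rewrite subr_ge0 ler_pdivrMr// mul1r.
Unshelve. all: by end_near. Qed.

Lemma limn_einf_ge (u : (\bar R)^nat) (l : \bar R) :
  (\forall n \near \oo, (l <= u n)%E) -> (l <= limn_einf u)%E.
Proof.
move=> [N _ lu]; rewrite limn_einf_lim.
apply: lime_ge; first exact: is_cvg_einfs.
near=> n; apply: le_ereal_inf_tmp => _ [k /= nk <-]; apply: lu => /=.
by apply: leq_trans nk; near: n; exact: nbhs_infty_ge.
Unshelve. all: by end_near. Qed.

(** The half-space argument in dimension [N = n + 1], with [|g|^2] bounded by
    [s^2 = sg N / (2 pi)] and the ball of squared radius
    [r^2 = N / (2 pi e sg)], so that [s / r = sg sqrt e].  The best parameters
    in the Markov inequalities are [l = N / (2 r^2) = pi e sg] for the volume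
    of the ball and [l = N / (2 s^2) = pi / sg] for the Gaussian tail; they give the
    bounds [b ^ N] and [d ^ N], where [b^2 = 1 / sg] and
    [d^2 = sg exp(1 - sg)] are both less than [1]. *)
Lemma max_dist_ge_Phi n (K : set 'rV[R]_n.+1) (sg t e : R) :
  bounded_set K -> lebesgue_measurable K -> volume K = 1%:E ->
  K = [set - x | x in K] ->
  1 < sg -> 0 <= t -> 0 <= e ->
  let b := expR (2^-1) * Num.sqrt (expR 1 * sg)^-1 in
  let d := expR (- ((sg - 1) / 2)) * Num.sqrt sg in
  e + d ^+ n.+1 < Phi (- (sg * t * Num.sqrt (expR 1))) * (1 - b ^+ n.+1) ->
  ((2 * t)%:E <= max_dist K e)%E.
Proof.
move=> bK mK K1 sK sg1 t0 e0 b d lt_e.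
have sg0 : 0 < sg by lra.
have pi0 := @pi_gt0 R.
(* N is kept opaque so that field does not expand n.+1. *)
have [N NE] : exists N : R, N = n.+1%:R by exists n.+1%:R.
have N0 : 0 < N by rewrite NE ltr0n.
pose s := Num.sqrt (sg * N / (pi *+ 2)).
pose r := Num.sqrt (N / (sg * (pi *+ 2) * expR 1)).
have pi2 : 0 < pi *+ 2 :> R by rewrite mulrn_wgt0.
have s2_gt0 : 0 < sg * N / (pi *+ 2) by rewrite !(divr_gt0, mulr_gt0).
have r2_gt0 : 0 < N / (sg * (pi *+ 2) * expR 1).
  by rewrite !(divr_gt0, mulr_gt0) ?expR_gt0.
have s2 : s ^+ 2 = sg * N / (pi *+ 2) by rewrite sqr_sqrtr// ltW.
have r2 : r ^+ 2 = N / (sg * (pi *+ 2) * expR 1) by rewrite sqr_sqrtr// ltW.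
have s0 : 0 < s by rewrite sqrtr_gt0.
have r0 : 0 < r by rewrite sqrtr_gt0.
(* pi is generalized before each call to field, which would unfold it. *)
have nz := (gt_eqF (expR_gt0 (1 : R)), gt_eqF sg0, gt_eqF N0).
have sr : s / r = sg * Num.sqrt (expR 1).
  apply: (@pexpIrn R 2) => //.
  - by rewrite nnegrE divr_ge0 ?sqrtr_ge0.
  - by rewrite nnegrE mulr_ge0 ?sqrtr_ge0// ltW.
  rewrite expr_div_n exprMn s2 r2 sqr_sqrtr ?expR_ge0//.
  by move: pi0; generalize (pi : R) => p p0; field; rewrite !nz gt_eqF.
have /caratheodory_borel_hull/(_ K1)[H [mH H1] HK] :=
  iffLR (@lebesgue_measurable_caratheodory R _ K) mK.
have [||||||g gs eg] := @exists_halfspace R n.+1 H (- (t * s)) (s ^+ 2) r e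
  (b ^+ n.+1) (d ^+ n.+1) mH H1.
- by rewrite oppr_le0 mulr_ge0// ltW.
- exact: r0.
- apply: le_trans (@ball_volume_le R n.+1 (sg * pi * expR 1) _ _) _.
    by rewrite !mulr_gt0 ?expR_gt0.
  rewrite lee_fin /b exprMn -expRM_natl -NE r2.
  rewrite (_ : _ * (N / _) = N * 2^-1); last first.
    by move: pi0; generalize (pi : R) => p p0; field; rewrite !nz gt_eqF.
  rewrite (_ : pi / _ = (expR 1 * sg)^-1)//.
  by move: pi0; generalize (pi : R) => p p0; field; rewrite !nz gt_eqF.
- apply: le_trans (@gauss_tuple_tail R n.+1 (pi / sg) _ _ _) _.
  + by rewrite divr_gt0.
  + by rewrite ler_pdivrMr// ler_peMr// ltW.
  rewrite lee_fin /d exprMn -expRM_natl -NE s2.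
  rewrite (_ : - (_ * _) = N * - ((sg - 1) / 2)); last first.
    by move: pi0; generalize (pi : R) => p p0; field; rewrite !nz gt_eqF.
  rewrite (_ : pi / _ = sg)//.
  by move: pi0; generalize (pi : R) => p p0; field; rewrite !nz gt_eqF.
- exact: e0.
- by rewrite mulNr -mulrA sr mulrCA mulrA; exact: lt_e.
apply: (@max_dist_ge R n K g s t e) => //.
by apply: le_trans eg (HK _ _); exact: measurable_halfspace.
Qed.

End asymptotics.

Theorem theorem6p6 (R : realType) (K : forall n : nat, set 'rV[R]_n)
    (K_bounded : forall n : nat, (0 < n)%N -> bounded_set (K n))
    (K_measurable : forall n : nat, (0 < n)%N -> lebesgue_measurable (K n))
    (K_volume : forall n : nat, (0 < n)%N -> volume (K n) = 1%:E)
    (K_symmetric : forall n : nat, (0 < n)%N -> K n = [set - x | x in K n]) :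
  (forall eps : R, 0 < eps -> eps < 1 / 2 ->
     ((limit_dist eps)%:E <= limn_einf (fun n : nat => max_dist (K n) eps))%E)
  /\
  limit_dist eps / (2 / Num.sqrt (pi * expR 1) * Num.sqrt (- ln eps))
    @[eps --> 0^'+] --> (1 : R).
Proof.
split; last exact: limit_dist_equiv.
move=> e e0 e12; have a0 := Phi_inv_lt0 e0 e12.
pose a := - Phi_inv e; pose w : R := Num.sqrt (expR 1).
have w0 : 0 < w by rewrite sqrtr_gt0 expR_gt0.
have limE : limit_dist e = 2 * (a / w).
  by rewrite /limit_dist -/w /a; field; rewrite gt_eqF.
(* Any t strictly below the limit value leaves a factor sg > 1 of room. *)
suff near_lim t : 0 < t -> t * w < a ->
    ((2 * t)%:E <= limn_einf (fun n : nat => max_dist (K n) e))%E.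
  apply/lee_subgt0Pr => d d0; rewrite limE -EFinB.
  pose m := Num.min (d / 2) (a / w / 2).
  have aw0 : 0 < a / w by rewrite divr_gt0// oppr_gt0.
  have m0 : 0 < m by rewrite lt_min; apply/andP; split; lra.
  have md : m <= d / 2 by rewrite ge_min lexx.
  have ma : m <= a / w / 2 by rewrite ge_min lexx orbT.
  apply: le_trans (near_lim (a / w - m) _ _); first by rewrite lee_fin; lra.
    lra.
  by rewrite -ltr_pdivlMr//; lra.
(* sg is chosen so that sg t w is the midpoint of t w and a. *)
move=> t0 twa; pose sg := (1 + a / (t * w)) / 2.
have tw0 : 0 < t * w by exact: mulr_gt0.
have sg1 : 1 < sg.
  by have : 1 < a / (t * w) by [rewrite ltr_pdivlMr ?mul1r]; rewrite /sg; lra.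
pose b : R := expR (2^-1) * Num.sqrt (expR 1 * sg)^-1.
pose d : R := expR (- ((sg - 1) / 2)) * Num.sqrt sg.
pose P := Phi (- (sg * t * w)).
have Pe : e < P.
  rewrite -[e]Phi_invK; last lra.
  apply: lt_Phi; rewrite ltrNr -/a -mulrA.
  rewrite (_ : sg * _ = (t * w + a) / 2); first lra.
  by rewrite /sg; field; rewrite (gt_eqF w0) (gt_eqF t0).
have sg0 : 0 < sg by lra.
have b0 : 0 <= b by rewrite mulr_ge0 ?expR_ge0.
have d0 : 0 <= d by rewrite mulr_ge0 ?expR_ge0.
have b1 : b < 1.
  rewrite -(@expr_lt1 _ 2)// exprMn -expRM_natl sqr_sqrtr; last first.
    by rewrite invr_ge0 mulr_ge0 ?expR_ge0// ltW.
  rewrite mulfV// invfM mulrA divff ?gt_eqF ?expR_gt0// mul1r.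
  by rewrite invf_lt1.
have d1 : d < 1.
  rewrite -(@expr_lt1 _ 2)// exprMn -expRM_natl sqr_sqrtr ?(ltW sg0)//.
  rewrite (_ : _ * - (_ / 2) = - (sg - 1)); last by field.
  rewrite expRN mulrC ltr_pdivrMr ?expR_gt0// mul1r.
  have : sg - 1 != 0 by lra.
  by move=> /expR_gt1Dx; rewrite subrKC.
apply: limn_einf_ge.
pose dl := (P - e) / 2.
have dl0 : 0 < dl by rewrite /dl; lra.
have bn : b ^+ n @[n --> \oo] --> (0 : R) by apply: cvg_expr; rewrite ger0_norm.
have dn : d ^+ n @[n --> \oo] --> (0 : R) by apply: cvg_expr; rewrite ger0_norm.
near=> n.
have bdl : b ^+ n < dl.
  have : `|0 - b ^+ n| < dl by near: n; move/cvgrPdist_lt : bn; apply.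
  by rewrite sub0r normrN ger0_norm// exprn_ge0.
have ddl : d ^+ n < dl.
  have : `|0 - d ^+ n| < dl by near: n; move/cvgrPdist_lt : dn; apply.
  by rewrite sub0r normrN ger0_norm// exprn_ge0.
have n0 : (0 < n)%N by near: n; exact: nbhs_infty_gt.
have [k nk] : exists k, n = k.+1 by exists n.-1; rewrite prednK.
rewrite nk in bdl ddl *.
apply: (@max_dist_ge_Phi R k (K k.+1) sg t e) => //; try exact: ltW.
- exact: K_bounded.
- exact: K_measurable.
- exact: K_volume.
- exact: K_symmetric.
rewrite -/b -/d -/w -/P.
have P1 : P <= 1 by exact: Phi_le1.
have : P * b ^+ k.+1 <= b ^+ k.+1 by rewrite ler_piMl ?exprn_ge0.
rewrite mulrBr mulr1; rewrite /dl in bdl ddl; lra.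
Unshelve. all: by end_near. Qed.
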